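(* Let $n\ge 4$. Then every endomorphism of $A_Z[D_n]$ lifts, that is, for every group endomorphism $\psi:A_Z[D_n]\to A_Z[D_n]$ there exists an endomorphism $\varphi:A[D_n]\to A[D_n]$ with $\varphi(Z(A[D_n]))\subset Z(A[D_n])$ whose induced endomorphism $\varphi_Z$ of $A_Z[D_n]$ equals $\psi$.
   Context: $A[D_n]$ is the Artin group with generators $t_1,\dots,t_n$ and relations $t_it_jt_i=t_jt_it_j$ if $\{i,j\}$ is an edge of the Coxeter graph $D_n$, and $t_it_j=t_jt_i$ if $i\ne j$ and $\{i,j\}$ is not an edge; the edges of $D_n$ are $\{i,i+1\}$ for $1\le i\le n-2$ and $\{n-2,n\}$. $Z(A[D_n])$ denotes its center and $A_Z[D_n]=A[D_n]/Z(A[D_n])$. An endomorphism $\varphi$ of $A[D_n]$ with $\varphi(Z(A[D_n]))\subset Z(A[D_n])$ induces an endomorphism $\varphi_Z$ of $A_Z[D_n]$. *)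

(* Defs.v *)
From HB Require Import structures.
From mathcomp Require Import all_boot.
From mathcomp Require Import boolp classical_sets.

Set Implicit Arguments.
Unset Strict Implicit.
Unset Printing Implicit Defensive.

Local Open Scope quotient_scope.
Local Open Scope classical_set_scope.
Local Open Scope group_scope.

(* The letter (i, true) stands for the generator i, and (i, false) for its
   inverse. *)
Notation word I := (seq (I * bool)).

Definition word_inv {I : Type} (w : word I) : word I :=
  rev [seq (l.1, ~~ l.2) | l <- w].

(* Two words are related iff they represent the same element of the group
   presented by the generators I and the relations u = v for R u v. *)
Inductive word_cong {I : Type} (R : word I -> word I -> Prop) :
    word I -> word I -> Prop :=
| WordRel u v : R u v -> word_cong R u v
| WordCancel i b : word_cong R [:: (i, b); (i, ~~ b)] [::]
| WordCat u1 u2 v1 v2 :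
    word_cong R u1 u2 -> word_cong R v1 v2 -> word_cong R (u1 ++ v1) (u2 ++ v2)
| WordRefl u : word_cong R u u
| WordSym u v : word_cong R u v -> word_cong R v u
| WordTrans u v w : word_cong R u v -> word_cong R v w -> word_cong R u w.

Lemma word_congVr (I : Type) (R : word I -> word I -> Prop) (u : word I) :
  word_cong R (u ++ word_inv u) [::].
Proof.
elim: u => [|[i b] u IHu]; first exact: WordRefl.
rewrite /word_inv /= rev_cons -cats1 catA; apply: WordTrans (WordCancel R i b).
have refl := WordRefl R.
exact: WordCat (refl [:: (i, b)]) (WordCat IHu (refl [:: (i, ~~ b)])).
Qed.

Lemma word_invK (I : Type) : involutive (@word_inv I).
Proof.
move=> u; rewrite /word_inv map_rev revK -map_comp -[RHS]map_id.
by apply: eq_map => -[i b] /=; rewrite negbK.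
Qed.

Lemma word_congVl (I : Type) (R : word I -> word I -> Prop) (u : word I) :
  word_cong R (word_inv u ++ u) [::].
Proof. by rewrite -{2}[u]word_invK; exact: word_congVr. Qed.

Lemma word_congV (I : Type) (R : word I -> word I -> Prop) (u v : word I) :
  word_cong R u v -> word_cong R (word_inv u) (word_inv v).
Proof.
move=> uv; have refl := WordRefl R.
apply: (@WordTrans _ _ _ (word_inv u ++ (v ++ word_inv v))).
  by have := WordCat (refl (word_inv u)) (WordSym (word_congVr R v)); rewrite cats0.
rewrite catA; apply: (WordCat _ (refl (word_inv v)) : word_cong R _ ([::] ++ _)).
apply: WordTrans (word_congVl R u).
exact: WordCat (refl _) (WordSym uv).
Qed.

Definition word_congb {I : Type} (R : word I -> word I -> Prop) : rel (word I) :=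
  fun u v => `[< word_cong R u v >].

Lemma word_congb_is_equiv (I : Type) (R : word I -> word I -> Prop) :
  equiv_class_of (word_congb R).
Proof.
split=> [u | u v | v u w].
- exact/asboolP/WordRefl.
- by apply/asboolP/asboolP; exact: WordSym.
- by move=> /asboolP uv /asboolP vw; apply/asboolP; exact: WordTrans uv vw.
Qed.

Canonical word_congb_equiv I R :=
  EquivRelPack (@word_congb_is_equiv I R).
Canonical word_congb_encModRel (I : choiceType) (R : word I -> word I -> Prop) :=
  defaultEncModRel (word_congb R).

(* The group presented by the generators I and the relations u = v for R u v *)
Definition presented (I : choiceType) (R : word I -> word I -> Prop) : Type :=
  {eq_quot word_congb R}.

HB.instance Definition _ (I : choiceType) (R : word I -> word I -> Prop) :
  EqQuotient _ (word_congb R) (presented R) := EqQuotient.on (presented R).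
HB.instance Definition _ (I : choiceType) (R : word I -> word I -> Prop) :=
  Choice.on (presented R).

Lemma presentedP (I : choiceType) (R : word I -> word I -> Prop) (u v : word I) :
  \pi_(presented R) u = \pi_(presented R) v <-> word_cong R u v.
Proof. by split=> [/eqmodP/asboolP | uv]; last exact/eqmodP/asboolP. Qed.

Definition presented_mul (I : choiceType) (R : word I -> word I -> Prop)
  (x y : presented R) : presented R := \pi_(presented R) (repr x ++ repr y).

Definition presented_inv (I : choiceType) (R : word I -> word I -> Prop)
  (x : presented R) : presented R := \pi_(presented R) (word_inv (repr x)).

Definition presented_one (I : choiceType) (R : word I -> word I -> Prop) :
  presented R := \pi_(presented R) [::].

Lemma word_cong_repr (I : choiceType) (R : word I -> word I -> Prop)
    (u : word I) : word_cong R (repr (\pi_(presented R) u)) u.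
Proof. by apply/presentedP; rewrite reprK. Qed.

Lemma presented_mulE (I : choiceType) (R : word I -> word I -> Prop)
    (u v : word I) :
  presented_mul (\pi_(presented R) u) (\pi_(presented R) v) =
  \pi_(presented R) (u ++ v).
Proof. by apply/presentedP/WordCat; exact: word_cong_repr. Qed.

Lemma presented_invE (I : choiceType) (R : word I -> word I -> Prop)
    (u : word I) :
  presented_inv (\pi_(presented R) u) = \pi_(presented R) (word_inv u).
Proof. exact/presentedP/word_congV/word_cong_repr. Qed.

Lemma presented_mulA (I : choiceType) (R : word I -> word I -> Prop) :
  associative (@presented_mul I R).
Proof.
elim/quotW=> x; elim/quotW=> y; elim/quotW=> z.
by rewrite (presented_mulE R y z) (presented_mulE R x y) !presented_mulE catA.
Qed.

Lemma presented_1mul (I : choiceType) (R : word I -> word I -> Prop) :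
  left_id (presented_one R) (@presented_mul I R).
Proof. by move=> x; rewrite /presented_one -[x]reprK presented_mulE. Qed.

Lemma presented_mul1 (I : choiceType) (R : word I -> word I -> Prop) :
  right_id (presented_one R) (@presented_mul I R).
Proof. by move=> x; rewrite /presented_one -[x]reprK presented_mulE cats0. Qed.

Lemma presented_Vmul (I : choiceType) (R : word I -> word I -> Prop) :
  left_inverse (presented_one R) (@presented_inv I R) (@presented_mul I R).
Proof.
move=> x; rewrite -[x]reprK presented_invE presented_mulE.
exact/presentedP/word_congVl.
Qed.

Lemma presented_mulV (I : choiceType) (R : word I -> word I -> Prop) :
  right_inverse (presented_one R) (@presented_inv I R) (@presented_mul I R).
Proof.
move=> x; rewrite -[x]reprK presented_invE presented_mulE.
exact/presentedP/word_congVr.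
Qed.

HB.instance Definition _ (I : choiceType) (R : word I -> word I -> Prop) :=
  isGroup.Build (presented R) (@presented_mulA I R) (@presented_1mul I R)
    (@presented_mul1 I R) (@presented_Vmul I R) (@presented_mulV I R).

(* Artin relations of a Coxeter graph all of whose edges carry the label 3 *)
Inductive artin_rel {I : eqType} (e : rel I) : word I -> word I -> Prop :=
| ArtinBraid i j : e i j ->
    artin_rel e [:: (i, true); (j, true); (i, true)]
                [:: (j, true); (i, true); (j, true)]
| ArtinComm i j : i != j -> ~~ e i j ->
    artin_rel e [:: (i, true); (j, true)] [:: (j, true); (i, true)].

Definition artin_group (I : choiceType) (e : rel I) : groupType :=
  presented (artin_rel e).

(* In terms of the labels 1, ..., n of the vertices, for n >= 3: the edges are
   {a, a + 1} for 1 <= a <= n - 2, and {n - 2, n}. The element i of 'I_n is the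
   vertex of label i.+1. *)
Definition D_arc (n a b : nat) : bool :=
  [&& 1 <= a, a <= n - 2 & b == a.+1] || (a == n - 2) && (b == n).

Definition D_edge {n : nat} : rel 'I_n :=
  fun i j => D_arc n i.+1 j.+1 || D_arc n j.+1 i.+1.

Definition artin_D (n : nat) : groupType := artin_group (@D_edge n).

Definition center (G : groupType) : set G := [set z | forall g, commute z g].
Arguments center : clear implicits.

Definition center_eq (G : groupType) : rel G :=
  fun x y => `[< center G (x^-1 * y) >].

Lemma center1 (G : groupType) : center G 1.
Proof. by move=> g; rewrite /commute mul1g mulg1. Qed.

Lemma centerM (G : groupType) (x y : G) :
  center G x -> center G y -> center G (x * y).
Proof. by move=> Zx Zy g; apply/commute_sym/commuteM; exact/commute_sym. Qed.

Lemma centerV (G : groupType) (x : G) : center G x -> center G x^-1.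
Proof. by move=> Zx g; apply/commute_sym/commuteV/commute_sym. Qed.

Lemma center_eq_is_equiv (G : groupType) : equiv_class_of (@center_eq G).
Proof.
split=> [x | x y | y x z].
- by apply/asboolP; rewrite mulVg; exact: center1.
- by apply/asboolP/asboolP => /centerV; rewrite invgM invgK.
- move=> /asboolP Zxy /asboolP Zyz; apply/asboolP.
  by have := centerM Zxy Zyz; rewrite -mulgA mulVKg.
Qed.

Canonical center_eq_equiv G := EquivRelPack (@center_eq_is_equiv G).
Canonical center_eq_encModRel (G : groupType) := defaultEncModRel (@center_eq G).

(* The quotient of G by its center *)
Definition central_quotient (G : groupType) : Type := {eq_quot @center_eq G}.

HB.instance Definition _ (G : groupType) :
  EqQuotient _ (@center_eq G) (central_quotient G) :=
  EqQuotient.on (central_quotient G).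
HB.instance Definition _ (G : groupType) := Choice.on (central_quotient G).

Lemma central_quotientP (G : groupType) (x y : G) :
  \pi_(central_quotient G) x = \pi_(central_quotient G) y <->
  center G (x^-1 * y).
Proof. by split=> [/eqmodP/asboolP | Zxy]; last exact/eqmodP/asboolP. Qed.

Lemma center_repr (G : groupType) (x : G) :
  center G ((repr (\pi_(central_quotient G) x))^-1 * x).
Proof. by apply/central_quotientP; rewrite reprK. Qed.

Definition central_quotient_mul (G : groupType) (x y : central_quotient G) :
  central_quotient G := \pi_(central_quotient G) (repr x * repr y).

Definition central_quotient_inv (G : groupType) (x : central_quotient G) :
  central_quotient G := \pi_(central_quotient G) (repr x)^-1.

Definition central_quotient_one (G : groupType) : central_quotient G := \pi_(central_quotient G) 1.

Lemma central_quotient_mulE (G : groupType) (x y : G) :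
  central_quotient_mul (\pi_(central_quotient G) x) (\pi_(central_quotient G) y) =
  \pi_(central_quotient G) (x * y).
Proof.
apply/central_quotientP.
set x' := repr _; set y' := repr _.
have -> : (x' * y')^-1 * (x * y) = (x'^-1 * x) * (y'^-1 * y).
  by rewrite invgM -mulgA (mulgA x'^-1) mulgA -(center_repr x) -mulgA.
by apply: centerM; exact: center_repr.
Qed.

Lemma central_quotient_invE (G : groupType) (x : G) :
  central_quotient_inv (\pi_(central_quotient G) x) =
  \pi_(central_quotient G) x^-1.
Proof.
apply/esym/central_quotientP; rewrite invgK.
set x' := repr _; have Z := center_repr x.
suff -> : x * x'^-1 = x'^-1 * x by [].
by apply: (mulgI x'^-1); rewrite mulgA; exact: Z.
Qed.

Lemma central_quotient_mulA (G : groupType) :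
  associative (@central_quotient_mul G).
Proof.
elim/quotW=> x; elim/quotW=> y; elim/quotW=> z.
by rewrite (central_quotient_mulE y z) (central_quotient_mulE x y) !central_quotient_mulE mulgA.
Qed.

Lemma central_quotient_1mul (G : groupType) :
  left_id (central_quotient_one G) (@central_quotient_mul G).
Proof.
move=> x; rewrite /central_quotient_one -[x]reprK central_quotient_mulE.
by rewrite mul1g.
Qed.

Lemma central_quotient_mul1 (G : groupType) :
  right_id (central_quotient_one G) (@central_quotient_mul G).
Proof.
move=> x; rewrite /central_quotient_one -[x]reprK central_quotient_mulE.
by rewrite mulg1.
Qed.

Lemma central_quotient_Vmul (G : groupType) :
  left_inverse (central_quotient_one G) (@central_quotient_inv G)
    (@central_quotient_mul G).
Proof.
move=> x; rewrite -[x]reprK central_quotient_invE central_quotient_mulE.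
by rewrite mulVg.
Qed.

Lemma central_quotient_mulV (G : groupType) :
  right_inverse (central_quotient_one G) (@central_quotient_inv G)
    (@central_quotient_mul G).
Proof.
move=> x; rewrite -[x]reprK central_quotient_invE central_quotient_mulE.
by rewrite mulgV.
Qed.

HB.instance Definition _ (G : groupType) :=
  isGroup.Build (central_quotient G) (@central_quotient_mulA G)
    (@central_quotient_1mul G) (@central_quotient_mul1 G)
    (@central_quotient_Vmul G) (@central_quotient_mulV G).

Definition artin_D_Z (n : nat) : groupType := central_quotient (artin_D n).

Notation endomorphism G := (UMagmaMorphism.type G G).

(* The map x Z(G) |-> phi(x) Z(G). The hypothesis makes it independent of the
   representative (lemma inducedE) and a group endomorphism. *)
Definition induced (G : groupType) (phi : endomorphism G)
    (phiZ : phi @` center G `<=` center G) (x : central_quotient G) :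
  central_quotient G := \pi_(central_quotient G) (phi (repr x)).

Lemma inducedE (G : groupType) (phi : endomorphism G)
    (phiZ : phi @` center G `<=` center G) (x : G) :
  induced phiZ (\pi_(central_quotient G) x) = \pi_(central_quotient G) (phi x).
Proof.
apply/central_quotientP; rewrite -gmulfV -gmulfM; apply: phiZ.
by exists ((repr (\pi_(central_quotient G) x))^-1 * x); first exact: center_repr.
Qed.

Lemma induced_monoid_morphism (G : groupType) (phi : endomorphism G)
    (phiZ : phi @` center G `<=` center G) :
  monoid_morphism (induced phiZ).
Proof.
split; first by rewrite -[1 in LHS]/(central_quotient_one G) inducedE gmulf1.
move=> x y; rewrite -[x]reprK -[y]reprK.
rewrite -[LHS]/(induced phiZ (central_quotient_mul _ _)) central_quotient_mulE.
by rewrite !inducedE gmulfM -central_quotient_mulE.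
Qed.

HB.instance Definition _ (G : groupType) (phi : endomorphism G)
    (phiZ : phi @` center G `<=` center G) :=
  isUMagmaMorphism.Build _ _ (induced phiZ) (induced_monoid_morphism phiZ).

(* Main.v *)
From HB Require Import structures.
Require Import Defs.
From mathcomp Require Import all_boot.
From mathcomp Require Import ssralg ssrint.
From mathcomp Require Import zify.
From mathcomp Require Import boolp classical_sets.

(** Choose preimages in A[D_n] of the images of the generators under the
    given endomorphism of the quotient. They satisfy every Artin relation up
    to a central factor, and the question is whether the preimages can be
    chosen so that all these factors are trivial. The exponent map, the
    morphism to the integers that sends every generator to 1, decides this,
    because a central element of exponent 0 is trivial ([center_exponent0]).
    Indeed, suppose that the chosen preimages all have the same exponent.
    Both sides of an Artin relation have the same length, hence the two
    products of preimages have the same exponent; their quotient is central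
    of exponent 0, so the relation holds exactly and the choice defines an
    endomorphism. A choice with constant exponent exists because the Coxeter
    graph is connected: along an edge i - j, a braid relation that holds up to
    a central factor z forces the exponents of the two preimages to differ by
    the exponent of z, and z can be absorbed in the preimage at j
    ([lift_endomorphism]). The lift preserves the center since it induces a
    map that fixes the trivial coset.

    The main work is [center_exponent0], which is proved with Garside's method
    in the monoid M that has the same presentation, for any finite connected
    triangle-free Coxeter graph such that M has a nontrivial central element.
    - If two atoms s and t both divide an element on the left, then so does
      their least common multiple, st or sts ([atom_completes]); this gives
      left cancellation ([mulI]) and least common multiples whenever there are
      common multiples ([lcm_exists]).
    - Two central elements a and b of M with the same length are equal
      ([central_eq]). A common left divisor d of maximal length permutes the
      atoms, in the sense that s d = d f(s); hence so do the cofactors of d in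
      a and b. If the cofactors are nontrivial, connectedness makes all the
      atoms divide both of them ([twists_divides]), against the maximality
      of d.
    - Let C be central and nontrivial in M. Every atom divides C, so inverting
      C already makes M a group, which has to be the Artin group. Therefore M
      embeds in the Artin group ([to_group_inj]) and every element of the
      latter is C^-k a with a in M ([fractionE]). If it is central of exponent
      0, then a is central with the length of C^k, thus a = C^k.

    For D_n an explicit C is the square of a product of n - 1 elements that
    resemble the Jucys-Murphy elements of braid groups
    ([full_twist_central]). *)

Set Implicit Arguments.
Unset Strict Implicit.
Unset Printing Implicit Defensive.

Local Open Scope quotient_scope.
Local Open Scope classical_set_scope.
Local Open Scope group_scope.

(** * The Artin monoid of a graph *)

Section ArtinMonoid.
Variables (I : choiceType) (e : rel I).

Inductive braid_move : seq I -> seq I -> Prop :=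
| BraidMove i j : e i j -> braid_move [:: i; j; i] [:: j; i; j]
| CommMove i j : i != j -> ~~ e i j -> braid_move [:: i; j] [:: j; i].

(** A chain of single moves, rather than the least congruence, so that the proof
    of [atom_completes] can follow the first letter of a word along it. *)
Inductive braid_cong (u : seq I) : seq I -> Prop :=
| BraidRefl : braid_cong u u
| BraidStep p l r q :
    braid_cong u (p ++ l ++ q) -> braid_move l r \/ braid_move r l ->
    braid_cong u (p ++ r ++ q).

Lemma braid_cong_trans u v w :
  braid_cong u v -> braid_cong v w -> braid_cong u w.
Proof. by move=> uv; elim=> // p l r q _ uw lr; exact: BraidStep uw lr. Qed.

Lemma braid_cong_sym u v : braid_cong u v -> braid_cong v u.
Proof.
elim=> [|p l r q _ IH lr]; first exact: BraidRefl.
apply: braid_cong_trans IH; apply: (BraidStep (BraidRefl _)).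
by case: lr; [right | left].
Qed.

Lemma braid_cong_cat u1 u2 v1 v2 :
  braid_cong u1 u2 -> braid_cong v1 v2 -> braid_cong (u1 ++ v1) (u2 ++ v2).
Proof.
move=> u12 v12; apply: (@braid_cong_trans _ (u2 ++ v1)).
  elim: u12 => [|p l r q _ IH lr]; first exact: BraidRefl.
  by move: IH; rewrite -!catA => IH; apply: BraidStep IH lr.
elim: v12 => [|p l r q _ IH lr]; first exact: BraidRefl.
by rewrite catA; apply: BraidStep lr; rewrite -catA.
Qed.

Lemma size_braid_cong u v : braid_cong u v -> size u = size v.
Proof.
elim=> // p l r q _ -> lr; rewrite !size_cat; congr (_ + (_ + _)).
by case: lr => -[].
Qed.

Definition braid_congb : rel (seq I) := fun u v => `[< braid_cong u v >].

Lemma braid_congb_is_equiv : equiv_class_of braid_congb.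
Proof.
split=> [u | u v | v u w].
- exact/asboolP/BraidRefl.
- by apply/asboolP/asboolP; exact: braid_cong_sym.
- by move=> /asboolP uv /asboolP vw; apply/asboolP; exact: braid_cong_trans uv vw.
Qed.

Canonical braid_congb_equiv := EquivRelPack braid_congb_is_equiv.
Canonical braid_congb_encModRel := defaultEncModRel braid_congb.

Definition artin_monoid : Type := {eq_quot braid_congb}.
HB.instance Definition _ : EqQuotient _ braid_congb artin_monoid :=
  EqQuotient.on artin_monoid.
HB.instance Definition _ := Choice.on artin_monoid.

Local Notation M := artin_monoid.
Local Notation pi := (\pi_M).

Lemma artin_monoidP u v : pi u = pi v <-> braid_cong u v.
Proof. by split=> [/eqmodP/asboolP | uv]; last exact/eqmodP/asboolP. Qed.

Definition artin_monoid_mul (x y : M) : M := pi (repr x ++ repr y).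

Lemma artin_monoid_mulE u v : artin_monoid_mul (pi u) (pi v) = pi (u ++ v).
Proof.
by apply/artin_monoidP/braid_cong_cat; apply/artin_monoidP; rewrite reprK.
Qed.

Lemma artin_monoid_mulA : associative artin_monoid_mul.
Proof.
elim/quotW=> x; elim/quotW=> y; elim/quotW=> z.
by rewrite (artin_monoid_mulE y z) (artin_monoid_mulE x y) !artin_monoid_mulE catA.
Qed.

Lemma artin_monoid_1mul : left_id (pi [::]) artin_monoid_mul.
Proof. by elim/quotW=> x; rewrite artin_monoid_mulE. Qed.

Lemma artin_monoid_mul1 : right_id (pi [::]) artin_monoid_mul.
Proof. by elim/quotW=> x; rewrite artin_monoid_mulE cats0. Qed.

HB.instance Definition _ := isMonoid.Build M
  artin_monoid_mulA artin_monoid_1mul artin_monoid_mul1.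

Definition atom (i : I) : M := pi [:: i].

Lemma pi_cat u v : pi (u ++ v) = pi u * pi v.
Proof. by rewrite -artin_monoid_mulE. Qed.

Lemma pi_nil : pi [::] = 1. Proof. by []. Qed.

Lemma pi_cons i u : pi (i :: u) = atom i * pi u.
Proof. by rewrite -pi_cat. Qed.

Lemma atom_ind (P : M -> Prop) :
  P 1 -> (forall i x, P x -> P (atom i * x)) -> forall x, P x.
Proof.
move=> P1 PM; elim/quotW; elim=> [|i u IHu]; first by rewrite pi_nil.
by rewrite pi_cons; exact: PM.
Qed.

Definition len (x : M) : nat := size (repr x).

Lemma len_pi u : len (pi u) = size u.
Proof. by apply/size_braid_cong/artin_monoidP; rewrite reprK. Qed.

Lemma lenM x y : len (x * y) = (len x + len y)%N.
Proof. by rewrite -[x]reprK -[y]reprK -pi_cat !len_pi size_cat. Qed.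

Lemma len1 : len 1 = 0%N. Proof. by rewrite -pi_nil len_pi. Qed.

Lemma len_atom i : len (atom i) = 1%N. Proof. exact: len_pi. Qed.

(** The sides of a move have at least two letters. *)
Lemma atom_inj : injective atom.
Proof.
suff cong1 u v : braid_cong u v -> size u = 1%N -> u = v.
  by move=> i j /artin_monoidP/cong1/(_ erefl)[].
elim=> // p l r q _ IH lr size1; move: (size1); rewrite (IH size1) !size_cat.
by case: lr => -[] ? ? /= *; lia.
Qed.

Lemma len0 x : len x = 0%N -> x = 1.
Proof. by move: x; apply: atom_ind => // i x _; rewrite lenM len_atom. Qed.

Lemma pi_move u v : braid_move u v -> pi u = pi v.
Proof.
move=> uv; apply/artin_monoidP; rewrite -[u]cats0 -[v]cats0.
by apply: (@BraidStep _ [::] u v [::] (BraidRefl _)); left.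
Qed.

Lemma atom_braid i j : e i j ->
  atom i * (atom j * atom i) = atom j * (atom i * atom j).
Proof. by move=> /BraidMove/pi_move; rewrite !pi_cons pi_nil !mulg1. Qed.

Lemma atom_comm i j : i != j -> ~~ e i j -> atom i * atom j = atom j * atom i.
Proof. by move=> ij /(CommMove ij)/pi_move; rewrite !pi_cons pi_nil !mulg1. Qed.

(** * Common multiples of two atoms, and left cancellation *)

(** The cofactor of [atom s] in the least common multiple of the atoms s and
    t. *)
Definition complement (s t : I) : M :=
  if s == t then 1 else if e s t then atom t * atom s else atom t.

(** The elements s X and t Y are one and the same multiple of the least common
    multiple of s and t. *)
Definition completes (s t : I) (X Y : M) : Prop :=
  exists Z, X = complement s t * Z /\ Y = complement t s * Z.

Hypothesis e_sym : symmetric e.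
Hypothesis e_trianglefree : forall r s t, e r s -> e s t -> ~~ e r t.

Lemma completes_sym s t X Y : completes s t X Y -> completes t s Y X.
Proof. by case=> Z [-> ->]; exists Z. Qed.

Lemma completes_refl s X : completes s s X X.
Proof. by exists X; rewrite /complement eqxx mul1g. Qed.

Lemma completes_eq s X Y : completes s s X Y -> X = Y.
Proof. by case=> Z [-> ->]. Qed.

Lemma completes_braid s t X Y : s != t -> e s t ->
  completes s t X Y <->
  exists Z, X = atom t * (atom s * Z) /\ Y = atom s * (atom t * Z).
Proof.
move=> st est; rewrite /completes /complement (negPf st) (eq_sym t) (negPf st).
by rewrite (e_sym t) est; split=> -[Z [-> ->]]; exists Z; rewrite !mulgA.
Qed.

Lemma completes_comm s t X Y : s != t -> ~~ e s t ->
  completes s t X Y <-> exists Z, X = atom t * Z /\ Y = atom s * Z.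
Proof.
move=> st est; rewrite /completes /complement (negPf st) (eq_sym t) (negPf st).
by rewrite (e_sym t) (negPf est).
Qed.

Lemma atom_braidK i j X : e i j ->
  atom i * (atom j * (atom i * X)) = atom j * (atom i * (atom j * X)).
Proof. by move=> eij; have := atom_braid eij; rewrite !mulgA => ->. Qed.

Lemma atom_commK i j X : i != j -> ~~ e i j ->
  atom i * (atom j * X) = atom j * (atom i * X).
Proof. by move=> ij eij; rewrite !mulgA atom_comm. Qed.

(** A loop would be a degenerate triangle. *)
Lemma edge_neq s t : e s t -> s != t.
Proof.
apply: contraTneq => <-; apply/negP => ess.
by have := e_trianglefree ess ess; rewrite ess.
Qed.

(** The relation between s X, r W and t Y is transitive provided that
    [atom_completes] holds for shorter elements. For distinct s, r, t the
    equation W = complement r s * Z = complement r t * Z' is solved by the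
    induction hypothesis, one letter at a time; the solution exhibits W as a
    multiple of the cofactor of r in the least common multiple of s, r and t.
    There are three cases, according to how many of s and t are joined to the
    middle atom r. *)
Section Transitivity.
Variable k : nat.
Hypothesis IH : forall s t X Y, len X < k ->
  atom s * X = atom t * Y -> completes s t X Y.

Let IHeq s X Y : len X < k -> atom s * X = atom s * Y -> X = Y.
Proof. by move=> ltk /(IH ltk)/completes_eq. Qed.

Let IHcomm s t X Y : s != t -> ~~ e s t -> len X < k ->
  atom s * X = atom t * Y -> exists Z, X = atom t * Z /\ Y = atom s * Z.
Proof. by move=> st est ltk /(IH ltk)/(completes_comm _ _ st est). Qed.

Let IHbraid s t X Y : s != t -> e s t -> len X < k ->
  atom s * X = atom t * Y ->
  exists Z, X = atom t * (atom s * Z) /\ Y = atom s * (atom t * Z).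
Proof. by move=> st est ltk /(IH ltk)/(completes_braid _ _ st est). Qed.

Lemma completes_trans_comm s r t X W Y :
  s != r -> r != t -> s != t -> ~~ e s r -> ~~ e r t -> len W = k ->
  completes s r X W -> completes r t W Y -> completes s t X Y.
Proof.
move=> sr rt st esr ert lenW.
move=> /(completes_comm _ _ sr esr)[Z [-> EZ]].
move=> /(completes_comm _ _ rt ert)[Z' [EZ' ->]].
have E : atom s * Z = atom t * Z' by rewrite -EZ.
have ltZ : len Z < k by rewrite -lenW EZ !lenM !len_atom; lia.
have [est | est] := boolP (e s t).
  have [Q [-> ->]] := IHbraid st est ltZ E.
  apply/(completes_braid _ _ st est); exists (atom r * Q).
  rewrite (atom_commK _ rt ert) (atom_commK Q _ _) 1?eq_sym // 1?e_sym //.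
  by rewrite !(@atom_commK r) // 1?eq_sym // 1?e_sym.
have [Q [-> ->]] := IHcomm st est ltZ E.
apply/(completes_comm _ _ st est); exists (atom r * Q).
by rewrite !(@atom_commK r) // 1?eq_sym // 1?e_sym.
Qed.

Lemma completes_trans_edge s r t X W Y :
  s != r -> r != t -> s != t -> e s r -> ~~ e r t -> len W = k ->
  completes s r X W -> completes r t W Y -> completes s t X Y.
Proof.
move=> sr rt st esr ert lenW.
move=> /(completes_braid _ _ sr esr)[Z [-> EZ]].
move=> /(completes_comm _ _ rt ert)[Z' [EZ' ->]].
have E : atom s * (atom r * Z) = atom t * Z' by rewrite -EZ.
have ltZ : len (atom r * Z) < k by rewrite -lenW EZ !lenM !len_atom; lia.
have ltZ' : len Z < k by rewrite -lenW EZ !lenM !len_atom; lia.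
have [est | est] := boolP (e s t).
  have [Q [E1 ->]] := IHbraid st est ltZ E.
  have [P [EP E2]] := IHcomm rt ert ltZ' E1.
  have rs : r != s by rewrite eq_sym.
  have ers : e r s by rewrite e_sym.
  have ltQ : len Q < k.
    by have := congr1 len E1; rewrite !lenM !len_atom; lia.
  have [N [EQ EP']] := IHbraid (t:=r) sr esr ltQ E2.
  apply/(completes_braid _ _ st est); exists (atom r * (atom s * (atom t * N))).
  (* Now X = r s t s r N and Y = r s t r s N, to be brought to the forms
     t s Z and s t Z with Z = r s t N. *)
  have ert' : ~~ e t r by rewrite e_sym.
  have tr : t != r by rewrite eq_sym.
  rewrite EP EP' EQ; split.
    rewrite (atom_braidK _ est) (atom_commK _ rt ert).
    by rewrite (atom_commK N tr ert') -(atom_braidK _ esr).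
  rewrite (atom_commK _ tr ert') -(atom_braidK _ esr).
  by rewrite (atom_braidK N est) (atom_commK _ rt ert).
have [Q [E1 ->]] := IHcomm st est ltZ E.
have [P [-> ->]] := IHcomm rt ert ltZ' E1.
apply/(completes_comm _ _ st est); exists (atom r * (atom s * P)).
rewrite (atom_commK P st est) (atom_commK _ rt ert); split=> //.
by rewrite (atom_braidK P esr).
Qed.

Lemma completes_trans_edges s r t X W Y :
  s != r -> r != t -> s != t -> e s r -> e r t -> len W = k ->
  completes s r X W -> completes r t W Y -> completes s t X Y.
Proof.
move=> sr rt st esr ert lenW.
have est : ~~ e s t by exact: e_trianglefree esr ert.
have rs : r != s by rewrite eq_sym.
have ers : e r s by rewrite e_sym.
move=> /(completes_braid _ _ sr esr)[Z [-> EZ]].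
move=> /(completes_braid _ _ rt ert)[Z' [EZ' ->]].
have E : atom s * (atom r * Z) = atom t * (atom r * Z') by rewrite -EZ.
have lt1 : len (atom r * Z) < k by rewrite -lenW EZ !lenM !len_atom; lia.
have lt2 : len Z < k by rewrite -lenW EZ !lenM !len_atom; lia.
have lt3 : len Z' < k by rewrite -lenW EZ' !lenM !len_atom; lia.
have [Q [E1 E2]] := IHcomm st est lt1 E.
have [P [-> EP]] := IHbraid rt ert lt2 E1.
have [P' [-> EP']] := IHbraid rs ers lt3 E2.
have E3 : atom r * (atom t * P) = atom r * (atom s * P') by rewrite -EP.
have lt4 : len (atom t * P) < k.
  by have := congr1 len E1; rewrite EP !lenM !len_atom in lt1 lt2 *; lia.
have E4 := IHeq lt4 E3.
have ltP : len P < k by move: lt4; rewrite lenM; lia.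
have ts : t != s by rewrite eq_sym.
have ets : ~~ e t s by rewrite e_sym.
have [N [-> ->]] := IHcomm ts ets ltP E4.
(* Now X = r s t r s N and Y = r t s r t N. *)
apply/(completes_comm _ _ st est).
exists (atom r * (atom t * (atom s * (atom r * N)))).
split.
  rewrite (atom_commK _ st est) (atom_braidK N esr).
  by rewrite (atom_braidK _ ert).
rewrite -(atom_commK _ st est) -(atom_braidK N ert).
by rewrite -(atom_braidK _ esr) (atom_commK _ st est).
Qed.

(** The case of a single edge from r to t reduces to that of a single edge from
    s to r by exchanging the roles of s and t. *)
Lemma completes_trans s r t X W Y : len W = k ->
  completes s r X W -> completes r t W Y -> completes s t X Y.
Proof.
move=> lenW; have [<- /completes_eq -> // | sr] := eqVneq s r.
have [-> XW /completes_eq <- // | rt] := eqVneq r t.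
have [<- [Z [-> EW]] [Z' [EW' ->]] | st] := eqVneq s t.
  suff -> : Z = Z' by apply: completes_refl.
  have E : complement r s * Z = complement r s * Z' by rewrite -EW.
  move: EW E; rewrite /complement eq_sym (negPf sr).
  case: ifP => _ EW E.
    have ltZ : len Z < k by rewrite -lenW EW !lenM !len_atom; lia.
    apply: (IHeq ltZ); move: E; rewrite -!mulgA; apply: IHeq.
    by rewrite -lenW EW !lenM !len_atom; lia.
  by apply: IHeq E; rewrite -lenW EW !lenM !len_atom; lia.
have [esr | esr] := boolP (e s r); have [ert | ert] := boolP (e r t).
- exact: completes_trans_edges.
- exact: completes_trans_edge.
- move=> /completes_sym XW /completes_sym WY; apply: completes_sym.
  by apply: (completes_trans_edge _ _ _ _ _ lenW WY XW);
    [rewrite eq_sym | rewrite eq_sym | rewrite eq_sym | rewrite e_sym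
    | rewrite e_sym].
- exact: completes_trans_comm.
Qed.

End Transitivity.

Lemma braid_move_completes l r : braid_move l r ->
  exists i l' j r',
    [/\ l = i :: l', r = j :: r' & completes i j (pi l') (pi r')].
Proof.
case=> [i j eij | i j ij eij].
  exists i, [:: j; i], j, [:: i; j]; split=> //; rewrite !pi_cons pi_nil.
  by apply/(completes_braid _ _ (edge_neq eij) eij); exists 1.
exists i, [:: j], j, [:: i]; split=> //; rewrite !pi_cons pi_nil.
by apply/(completes_comm _ _ ij eij); exists 1.
Qed.

(** Garside's lemma: induction on the length of X, then on a chain of moves from
    s X to t Y. A move that does not touch the first letter only changes the
    tail, a move at the front is an instance of the lemma, and the links are
    composed by [completes_trans]. *)
Lemma atom_completes s t X Y : atom s * X = atom t * Y -> completes s t X Y.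
Proof.
have [k] := ubnP (len X); elim: k => // k IH in s t X Y *.
rewrite ltnS => leXk E.
have [ltXk|] := ltnP (len X) k; first exact: IH.
move=> lekX; have lenX : len X = k by apply/eqP; rewrite eqn_leq leXk.
have: braid_cong (s :: repr X) (t :: repr Y).
  by apply/artin_monoidP; rewrite !pi_cons !reprK.
move Ew : (t :: repr Y) => w sw.
suff {E Ew} : forall t' v, w = t' :: v -> completes s t' X (pi v).
  by move/(_ t (repr Y) (esym Ew)); rewrite reprK.
have sizew : size w = k.+1.
  by have := size_braid_cong sw; rewrite /= -lenX -[X in len X]reprK len_pi.
elim: sw sizew => [_|p l r q su IHu lr sizew] t' v.
  by case=> <- <-; rewrite reprK; apply: completes_refl.
have lrE : pi l = pi r by case: lr => /pi_move.
have size_lr : size l = size r.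
  by apply: size_braid_cong; apply/artin_monoidP.
have sizew' : size (p ++ l ++ q) = k.+1.
  by rewrite -sizew !size_cat size_lr.
case: p => [|i p] in su IHu sizew sizew' *; last first.
  case=> <- <-; have := IHu sizew' i _ erefl.
  by rewrite !pi_cat lrE.
have [i [l' [j [r' [El Er ijlr]]]]] : exists i l' j r',
    [/\ l = i :: l', r = j :: r' & completes i j (pi l') (pi r')].
  case: lr => /braid_move_completes[i [l' [j [r' [-> -> ij]]]]].
    by exists i, l', j, r'.
  by exists j, r', i, l'; split=> //; apply: completes_sym.
rewrite {}El {}Er /= in IHu sizew' *; case=> <- <-.
apply: (completes_trans IH _ (IHu sizew' _ _ erefl)).
  by case: sizew'; rewrite len_pi.
case: ijlr => Z [E1 E2]; exists (Z * pi q).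
by rewrite !pi_cat E1 E2 !mulgA.
Qed.
Lemma complementE s t : s != t ->
  atom s * complement s t = atom t * complement t s.
Proof.
move=> st; rewrite /complement (negPf st) (eq_sym t) (negPf st) (e_sym t).
by have [est | est] := boolP (e s t); [apply: atom_braid | apply: atom_comm].
Qed.

Lemma mulI (x a b : M) : x * a = x * b -> a = b.
Proof.
move: x; apply: atom_ind => [|s x IH]; first by rewrite !mul1g.
by rewrite -!mulgA => /atom_completes/completes_eq.
Qed.

(** * Least common multiples and central elements *)

Definition divides (x w : M) : Prop := exists y, w = x * y.

Lemma divides_refl x : divides x x.
Proof. by exists 1; rewrite mulg1. Qed.

Lemma divides_trans y x z : divides x y -> divides y z -> divides x z.
Proof. by move=> [a ->] [b ->]; exists (a * b); rewrite mulgA. Qed.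

Lemma divides_mull (x y : M) : divides x (x * y).
Proof. by exists y. Qed.

Lemma divides_mul2l (z x y : M) : divides (z * x) (z * y) <-> divides x y.
Proof.
split=> -[a]; first by rewrite -mulgA => /mulI ->; exists a.
by move=> ->; exists a; rewrite mulgA.
Qed.

Lemma divides_len x y : divides x y -> len x <= len y.
Proof. by move=> [a ->]; rewrite lenM leq_addr. Qed.

Lemma atom_case (x : M) : x = 1 \/ exists s y, x = atom s * y.
Proof. by move: x; apply: atom_ind => [|s y _]; [left | right; exists s, y]. Qed.

Definition is_lcm (x y m : M) : Prop :=
  [/\ divides x m, divides y m &
       forall w, divides x w -> divides y w -> divides m w].

(** With x = s x' and y = t y', the atoms are handled by [atom_completes]. A
    common multiple of x and y is also one of s and t, so its cofactor u of s
    is a multiple of both x' and [complement s t]. Let m1 be their least common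
    multiple, which is available by induction; then s m1 = t m2 is the least
    common multiple of x and t, and t lcm(m2, y') that of x and y. *)
Lemma lcm_exists w x y : divides x w -> divides y w -> exists m, is_lcm x y m.
Proof.
have [k] := ubnP (len w); elim: k => // k IH in w x y *; rewrite ltnS => lewk.
have [-> | [s [x' ->]]] := atom_case x.
  by exists y; split=> //; [exists y; rewrite mul1g | apply: divides_refl].
have [-> | [t [y' ->]]] := atom_case y.
  move=> _ _; exists (atom s * x'); split=> //; first exact: divides_refl.
  by exists (atom s * x'); rewrite mul1g.
have step v : divides (atom s * x') v -> divides (atom t * y') v ->
  exists u u', [/\ v = atom s * u, v = atom t * u', divides x' u,
    divides y' u' & divides (complement s t) u].
  move=> [a ->] [b E]; exists (x' * a), (y' * b); rewrite !mulgA; split=> //.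
  - exact: divides_mull.
  - exact: divides_mull.
  move: E; rewrite -!mulgA => /atom_completes[Z [-> _]]; exact: divides_mull.
move=> xw yw; have [u [u' [Eu Eu' xu yu' cu]]] := step w xw yw.
have ltu : len u < k by move: lewk; rewrite Eu lenM len_atom; lia.
have ltu' : len u' < k by move: lewk; rewrite Eu' lenM len_atom; lia.
have [m1 [xm1 cm1 m1P]] := IH _ _ _ ltu xu cu.
have [m2 Em2] : divides (atom t) (atom s * m1).
  case: cm1 => n ->; have [<- | st] := eqVneq s t; first exact: divides_mull.
  by rewrite mulgA complementE // -mulgA; apply: divides_mull.
have m2u v v' : v = atom s * v' -> forall z, v = atom t * z -> divides m1 v' ->
    divides m2 z.
  move=> -> z Ez /(divides_mul2l (atom s)); rewrite Em2 Ez.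
  by move/divides_mul2l.
have [m3 [m23 y'm3 m3P]] := IH _ _ _ ltu' (m2u _ _ Eu _ Eu' (m1P _ xu cu)) yu'.
exists (atom t * m3); split.
- apply: (@divides_trans (atom s * m1)); first exact/divides_mul2l.
  by rewrite Em2; apply/divides_mul2l.
- exact/divides_mul2l.
move=> v xv yv; have [a [b [Ea Eb xa yb ca]]] := step v xv yv.
rewrite Eb; apply/divides_mul2l/m3P => //.
exact: m2u Ea _ Eb (m1P _ xa ca).
Qed.

(** Central elements satisfy this with f the identity; a Garside element does
    with f its permutation of the atoms. *)
Definition twists (f : I -> I) (a : M) : Prop :=
  forall s, atom s * a = a * atom (f s).

Hypothesis e_connected : forall P : I -> Prop,
  (forall i j, e i j -> P i -> P j) -> forall i j, P i -> P j.

(** If s divides a and t is a neighbour of s, then t a = a f(t) is divisible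
    by both, hence by t s t, so that s t divides a. Moving the leading s to the
    right end of a, where it becomes f(s), shows that t divides a. *)
Lemma twists_divides f a : twists f a -> a != 1 ->
  forall s, divides (atom s) a.
Proof.
move=> fa a1.
have [a1' | [s [c Ea]]] := atom_case a; first by rewrite a1' eqxx in a1.
move=> t; apply: (@e_connected (fun t => divides (atom t) a) _ s); last first.
  by rewrite Ea; apply: divides_mull.
move=> {c Ea}s {}t est [c Ea].
have [Z Ec] : divides (atom t) c.
  have := fa t; rewrite Ea -mulgA => /atom_completes.
  have ets : e t s by rewrite e_sym.
  by move=> /(completes_braid _ _ (edge_neq ets) ets)[Z [/mulI -> _]]; exists Z.
have /mulI E : atom s * a = atom s * (c * atom (f s)) by rewrite fa {1}Ea mulgA.
by rewrite E Ec; exists (Z * atom (f s)); rewrite mulgA.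
Qed.

Definition central (a : M) : Prop := twists id a.

Lemma centralC a x : central a -> x * a = a * x.
Proof.
move=> ca; move: x; apply: atom_ind => [|s x IH]; first by rewrite mul1g mulg1.
by rewrite -mulgA IH !mulgA ca.
Qed.

Lemma max_common_divisor (a b : M) : exists d, [/\ divides d a, divides d b &
  forall d', divides d' a -> divides d' b -> len d' <= len d].
Proof.
pose P k := `[< exists d, [/\ divides d a, divides d b & len d = k] >].
have exP : exists k, P k.
  exists 0%N; apply/asboolP; exists 1; rewrite len1.
  by split=> //; [exists a | exists b]; rewrite mul1g.
have ubP k : P k -> k <= len a by move=> /asboolP[d [/divides_len ? _ <-]].
case: (ex_maxnP exP ubP) => k /asboolP[d [da db <-]] max.
by exists d; split=> // d' d'a d'b; apply: max; apply/asboolP; exists d'.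
Qed.

End ArtinMonoid.

Section Central.
Variables (I : finType) (e : rel I).
Hypothesis e_sym : symmetric e.
Hypothesis e_trianglefree : forall r s t, e r s -> e s t -> ~~ e r t.
Hypothesis e_connected : forall P : I -> Prop,
  (forall i j, e i j -> P i -> P j) -> forall i j, P i -> P j.
Local Notation M := (artin_monoid e).

(** A longest common divisor d of a and b divides s a = a s and s b = b s, and
    so does s d. Hence so does their least common multiple, which cannot be
    longer than s d, since otherwise its cofactor of s would be a common
    divisor of a and b longer than d. So d divides s d, that is,
    s d = d f(s). *)
Lemma central_eq (a b : M) : central a -> central b -> len a = len b -> a = b.
Proof.
move=> ca cb ab.
have [d [[a' Ea] [b' Eb] max]] := max_common_divisor a b.
have /choice[f df] : forall s, exists t, atom e s * d = d * atom e t.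
  move=> s.
  have [da db] : divides d (atom e s * a) /\ divides d (atom e s * b).
    rewrite ca cb Ea Eb -!mulgA; split; exact: divides_mull.
  have [sda sdb] : divides (atom e s * d) (atom e s * a) /\
                   divides (atom e s * d) (atom e s * b).
    by rewrite Ea Eb; split; apply/(divides_mul2l e_sym e_trianglefree);
      apply: divides_mull.
  have [m [[c Ec] [c' Ec'] mP]] := lcm_exists e_sym e_trianglefree da sda.
  have := mP _ da sda; have := mP _ db sdb; rewrite Ec' -!mulgA.
  move=> /(divides_mul2l e_sym e_trianglefree) dcb.
  move=> /(divides_mul2l e_sym e_trianglefree) dca.
  have c'1 : c' = 1 by apply: len0; have := max _ dca dcb; rewrite lenM; lia.
  rewrite c'1 mulg1 in Ec'; rewrite -Ec' Ec.
  have lenc : len c = 1%N.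
    by have := congr1 (@len _ e) Ec; rewrite {1}Ec' !lenM len_atom; lia.
  have [c1 | [t [c1 Ec1]]] := atom_case c; first by rewrite c1 len1 in lenc.
  exists t; rewrite Ec1 (len0 (x := c1)) ?mulg1 //.
  by move: lenc; rewrite Ec1 lenM len_atom; lia.
have fa : forall s, atom e (f s) * a' = a' * atom e s.
  move=> s; apply: (mulI e_sym e_trianglefree (x := d)).
  by rewrite mulgA -df -mulgA -Ea ca Ea -mulgA.
have fb : forall s, atom e (f s) * b' = b' * atom e s.
  move=> s; apply: (mulI e_sym e_trianglefree (x := d)).
  by rewrite mulgA -df -mulgA -Eb cb Eb -mulgA.
(* [twists g a'] needs the inverse g of f, and f is invertible because it is an
   injective map from a finite set to itself. *)
have f_inj : injective f.
  move=> s t st; apply: (@atom_inj _ e).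
  by apply: (mulI e_sym e_trianglefree (x := a')); rewrite -!fa st.
have [g fK gK] := injF_bij f_inj.
have ga : twists g a' by move=> s; rewrite -fa gK.
have gb : twists g b' by move=> s; rewrite -fb gK.
have lenab : len a' = len b' by move: ab; rewrite Ea Eb !lenM; lia.
have [a1 | a1] := eqVneq a' 1.
  rewrite Ea Eb a1; congr (_ * _); apply/esym/len0; by rewrite -lenab a1 len1.
have [b1 | b1] := eqVneq b' 1.
  by move: a1; rewrite (len0 (x := a')) ?eqxx // lenab b1 len1.
have [a1' | [s _]] := atom_case a'; first by rewrite a1' eqxx in a1.
have [c Ec] := twists_divides e_sym e_trianglefree e_connected ga a1 s.
have [c' Ec'] := twists_divides e_sym e_trianglefree e_connected gb b1 s.
have da : divides (d * atom e s) a.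
  by rewrite Ea Ec mulgA; apply: divides_mull.
have db : divides (d * atom e s) b.
  by rewrite Eb Ec' mulgA; apply: divides_mull.
by have := max _ da db; rewrite lenM len_atom addn1 ltnn.
Qed.
End Central.

(** * Morphisms out of a presented group, and the exponent *)

Section Presented.
Variables (I : choiceType) (R : word I -> word I -> Prop).
Local Notation G := (presented R).
Local Notation pi := (\pi_G).

Definition presented_gen (i : I) : G := pi [:: (i, true)].

Lemma presented_pi_cat u v : pi (u ++ v) = pi u * pi v.
Proof. by rewrite -presented_mulE. Qed.

Lemma presented_pi_cons i b u :
  pi ((i, b) :: u) =
    (if b then presented_gen i else (presented_gen i)^-1) * pi u.
Proof.
rewrite -cat1s presented_pi_cat; congr (_ * _); case: b => //.
by rewrite -[_^-1]/(presented_inv _) presented_invE.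
Qed.

Lemma presented_ind (P : G -> Prop) :
  P 1 -> (forall i x, P x -> P (presented_gen i * x)) ->
  (forall i x, P x -> P ((presented_gen i)^-1 * x)) -> forall x, P x.
Proof.
move=> P1 PM PV; elim/quotW; elim=> [|[i b] u IHu]; first exact: P1.
by rewrite presented_pi_cons; case: b; [apply: PM | apply: PV].
Qed.

Variables (H : groupType) (v : I -> H).

Definition word_eval (w : word I) : H :=
  \prod_(l <- w) (if l.2 then v l.1 else (v l.1)^-1).

Lemma word_eval_cat x y : word_eval (x ++ y) = word_eval x * word_eval y.
Proof. by rewrite /word_eval big_cat. Qed.

Hypothesis vR : forall x y, R x y -> word_eval x = word_eval y.

Lemma word_eval_cong x y : word_cong R x y -> word_eval x = word_eval y.
Proof.
elim=> {x y} // [i b | x y x' y' _ IH _ IH' | x y z _ -> _ //].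
- by rewrite /word_eval !big_cons big_nil /= mulg1; case: b; rewrite ?mulgV ?mulVg.
- by rewrite !word_eval_cat IH IH'.
Qed.

Lemma presented_lift :
  exists phi : UMagmaMorphism.type G H, forall i, phi (presented_gen i) = v i.
Proof.
pose f (x : G) := word_eval (repr x).
have fE w : f (pi w) = word_eval w.
  by apply: word_eval_cong; apply: word_cong_repr.
have fM : monoid_morphism f.
  split; first by rewrite -[1]/(pi [::]) fE /word_eval big_nil.
  by elim/quotW=> x; elim/quotW=> y; rewrite -presented_pi_cat !fE word_eval_cat.
pose phi : UMagmaMorphism.type G H := HB.pack f (isUMagmaMorphism.Build _ _ f fM).
exists phi => i; rewrite -[LHS]/(f _) fE /word_eval big_cons big_nil /=.
exact: mulg1.
Qed.

End Presented.

Lemma center_presented (I : choiceType) (R : word I -> word I -> Prop)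
    (z : presented R) :
  (forall i, commute z (presented_gen R i)) -> center _ z.
Proof.
move=> zi; apply: presented_ind => [|i x zx|i x zx]; first exact: commute1.
  exact: commuteM.
by apply: commuteM => //; apply: commuteV.
Qed.

Section Exponent.
Variables (I : choiceType) (e : rel I).
Local Notation G := (artin_group e).

Definition word_exponent (w : word I) : int :=
  (\sum_(l <- w) (if l.2 then 1 else -1))%R.

Lemma word_exponent_cong u v :
  word_cong (artin_rel e) u v -> word_exponent u = word_exponent v.
Proof.
rewrite /word_exponent.
elim=> {u v} // [u v | i b | u v u' v' _ IH _ IH' | u v w _ -> _ //].
- by case=> *; rewrite !big_cons !big_nil.
- by rewrite !big_cons big_nil; case: b.
- by rewrite !big_cat /= IH IH'.
Qed.

Definition exponent (x : G) : int := word_exponent (repr x).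

Lemma exponent_pi w : exponent (\pi_G w) = word_exponent w.
Proof. exact/word_exponent_cong/word_cong_repr. Qed.

Lemma exponentM x y : exponent (x * y) = (exponent x + exponent y)%R.
Proof.
elim/quotW: x => x; elim/quotW: y => y.
by rewrite -presented_pi_cat !exponent_pi /word_exponent big_cat.
Qed.

Lemma exponent1 : exponent 1 = 0%R.
Proof. by rewrite -[1]/(\pi_G [::]) exponent_pi /word_exponent big_nil. Qed.

Lemma exponentV x : exponent x^-1 = (- exponent x)%R.
Proof.
have := exponentM x x^-1; rewrite mulgV exponent1.
by move/esym/eqP; rewrite GRing.addrC GRing.addr_eq0 => /eqP.
Qed.

End Exponent.

(** * The Artin group as a group of fractions *)

Section Embedding.
Variables (I : choiceType) (e : rel I).
Local Notation M := (artin_monoid e).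
Local Notation G := (artin_group e).

Local Notation gen := (presented_gen (artin_rel e)).

Definition positive_word (u : seq I) : word I := [seq (i, true) | i <- u].

Lemma positive_word_cong u v : braid_cong e u v ->
  word_cong (artin_rel e) (positive_word u) (positive_word v).
Proof.
have moveP x y : braid_move e x y ->
    word_cong (artin_rel e) (positive_word x) (positive_word y).
  by case=> [i j eij | i j ij eij]; apply: WordRel; constructor.
elim=> [|p l r q _ IH lr]; first exact: WordRefl.
apply: (WordTrans IH); rewrite /positive_word !map_cat.
apply: WordCat (WordRefl _ _) (WordCat _ (WordRefl _ _)).
by case: lr => /moveP // ?; apply: WordSym.
Qed.

Definition to_group (x : M) : G := \pi_G (positive_word (repr x)).

Lemma to_group_pi u : to_group (\pi_M u) = \pi_G (positive_word u).
Proof.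
by apply/presentedP/positive_word_cong; apply/artin_monoidP; rewrite reprK.
Qed.

Lemma to_groupM x y : to_group (x * y) = to_group x * to_group y.
Proof.
elim/quotW: x => x; elim/quotW: y => y.
by rewrite -pi_cat !to_group_pi /positive_word map_cat presented_pi_cat.
Qed.

Lemma to_group1 : to_group 1 = 1.
Proof. exact: (to_group_pi [::]). Qed.

Lemma to_group_atom i : to_group (atom e i) = gen i.
Proof. exact: (to_group_pi [:: i]). Qed.

Lemma to_groupX x k : to_group (x ^+ k) = to_group x ^+ k.
Proof. by elim: k => [|k IHk]; rewrite ?to_group1 // !expgS to_groupM IHk. Qed.

Lemma exponent_to_group x : exponent (to_group x) = Posz (len x).
Proof.
move: x; apply: atom_ind => [|i x IH].
  by rewrite to_group1 exponent1 len1.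
rewrite to_groupM exponentM IH lenM to_group_atom exponent_pi.
by rewrite /word_exponent big_seq1 len_atom.
Qed.

Hypothesis e_sym : symmetric e.
Hypothesis e_trianglefree : forall r s t, e r s -> e s t -> ~~ e r t.
Variables (C : M) (cofactor : I -> M).
Hypothesis C_central : central C.
Hypothesis cofactorE : forall i, C = atom e i * cofactor i.

(** A word stands for the fraction C^-k a, where k is its number of inverse
    letters and a the product of its letters, each inverse i^-1 being replaced
    by the cofactor of i, that is, by C i^-1. *)
Definition denominator (w : word I) : nat := count (fun l => ~~ l.2) w.
Definition numerator (w : word I) : M :=
  \prod_(l <- w) (if l.2 then atom e l.1 else cofactor l.1).

Lemma centralX (x : M) k : x * C ^+ k = C ^+ k * x.
Proof. by apply/commuteX/centralC. Qed.

(** Equality of the fractions, cross-multiplied. Left cancellation in the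
    monoid is what makes it transitive. *)
Lemma fraction_cong u v : word_cong (artin_rel e) u v ->
  C ^+ denominator v * numerator u = C ^+ denominator u * numerator v.
Proof.
rewrite /denominator /numerator.
elim=> {u v} // [u v | i b | u u' v v' _ IH _ IH' | u v w _ IH _ IH'].
- case=> [i j eij | i j ij eij]; rewrite !big_cons !big_nil !mul1g !mulg1.
    exact: atom_braid.
  exact: atom_comm.
- rewrite !big_cons !big_nil !mul1g !mulg1; case: b => //=.
  apply: (mulI e_sym e_trianglefree (x := atom e i)).
  by rewrite mulgA -cofactorE centralC // mulg1.
- rewrite !count_cat !big_cat /= !expgnDr.
  rewrite !mulgA -(mulgA _ _ (\prod_(l <- u) _)).
  rewrite -(centralX (\prod_(l <- u) _)) mulgA IH.
  by rewrite -mulgA IH' !mulgA -(mulgA _ _ (C ^+ count _ v)) centralX mulgA.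
- apply: (mulI e_sym e_trianglefree (x := C ^+ count (fun l => ~~ l.2) v)).
  rewrite mulgA -expgnDr addnC expgnDr -mulgA IH mulgA -expgnDr addnC expgnDr.
  by rewrite -mulgA IH' mulgA -expgnDr addnC expgnDr -mulgA.
Qed.

Lemma numerator_positive u : numerator (positive_word u) = \pi_M u.
Proof.
rewrite /numerator big_map /=; elim: u => [|i u IH]; first by rewrite big_nil.
by rewrite big_cons IH pi_cons.
Qed.

Lemma to_group_inj : injective to_group.
Proof.
elim/quotW=> x; elim/quotW=> y.
rewrite !to_group_pi => /presentedP/fraction_cong; rewrite !numerator_positive.
have den0 u : denominator (positive_word u) = 0%N.
  by rewrite /denominator count_map; elim: u.
by rewrite !den0 !mul1g.
Qed.

Lemma to_group_central a : center G (to_group a) <-> central a.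
Proof.
split=> [Za s | ca].
  by apply: to_group_inj; rewrite !to_groupM; apply/esym/Za.
apply: center_presented => i.
by rewrite /commute -!to_group_atom -!to_groupM ca.
Qed.

Lemma fractionE (w : word I) :
  to_group C ^+ denominator w * \pi_G w = to_group (numerator w).
Proof.
have ZC : forall x, commute (to_group C) x by apply/to_group_central.
elim: w => [|[i b] w IHw].
  by rewrite /numerator big_nil to_group1 expg0 mul1g.
rewrite /numerator big_cons to_groupM -/(numerator w) -IHw presented_pi_cons.
case: b => /=.
  rewrite to_group_atom add0n !mulgA; congr (_ * _).
  by apply/esym/commuteX/commute_sym.
have ZCX : commute (to_group C ^+ (denominator w).+1) (gen i)^-1.
  by apply/commute_sym/commuteX/commute_sym/ZC.
rewrite add1n mulgA -/(denominator w) ZCX expgS {1}(cofactorE i) to_groupM.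
by rewrite to_group_atom !mulgA mulVg mul1g.
Qed.

Hypothesis central_eq : forall a b : M,
  central a -> central b -> len a = len b -> a = b.

(** A central fraction C^-k a has a central numerator, because the monoid embeds
    in the group; exponent 0 means that a is as long as C^k. *)
Lemma center_exponent0 z : center G z -> exponent z = 0%R -> z = 1.
Proof.
move=> Zz z0; have := fractionE (repr z); rewrite reprK.
set k := denominator _; set a := numerator _ => E.
have ZC : center G (to_group C) by apply/to_group_central.
have ZCk : center G (to_group C ^+ k).
  by move=> x; apply/commute_sym/commuteX/commute_sym.
have ca : central a by apply/to_group_central; rewrite -E; apply: centerM.
have cCk : central (C ^+ k) by apply/to_group_central; rewrite to_groupX.
have aCk : a = C ^+ k.
  apply: central_eq => //; apply/eqP; rewrite -eqz_nat -!exponent_to_group -E.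
  by rewrite to_groupX exponentM z0 GRing.addr0.
by apply: (mulgI (to_group C ^+ k)); rewrite mulg1 E aCk to_groupX.
Qed.

End Embedding.

(** * Lifting endomorphisms of the central quotient *)

Section Lift.
Variables (I : finType) (e : rel I).
Local Notation G := (artin_group e).
Local Notation gen := (presented_gen (artin_rel e)).
Hypothesis e_connected : forall P : I -> Prop,
  (forall i j, e i j -> P i -> P j) -> forall i j, P i -> P j.
Hypothesis center_exponent0 :
  forall z : G, center G z -> exponent z = 0%R -> z = 1.
Local Notation Q := (central_quotient G).


Lemma central_quotient_pi_morphism : monoid_morphism (\pi_Q : G -> Q).
Proof. by split=> // x y; rewrite -central_quotient_mulE. Qed.

Lemma central_quotient_pi1 (z : G) : \pi_Q z = 1 <-> center G z.
Proof.
rewrite -[1]/(\pi_Q 1); split=> [/esym|Zz].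
  by move/central_quotientP; rewrite invg1 mul1g.
by apply/esym/central_quotientP; rewrite invg1 mul1g.
Qed.

(** The vertex i0 fixes the common exponent N of the chosen preimages. *)
Lemma lift_endomorphism (i0 : I) (psi : endomorphism Q) :
  exists (phi : endomorphism G) (phiZ : phi @` center G `<=` center G),
    induced phiZ =1 psi.
Proof.
pose p : UMagmaMorphism.type G Q :=
  HB.pack (\pi_Q : G -> Q)
    (isUMagmaMorphism.Build _ _ _ central_quotient_pi_morphism).
pose u i : G := repr (psi (p (gen i))).
have uE i : p (u i) = psi (p (gen i)) by rewrite -[p _]/(\pi_Q _) reprK.
pose N := exponent (u i0).
have /choice[v vP] : forall i, exists v,
    p v = psi (p (gen i)) /\ exponent v = N.
  move=> i; apply: (@e_connected (fun i => exists v,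
    p v = psi (p (gen i)) /\ exponent v = N) _ i0); last by exists (u i0).
  move=> {}i j eij [v [vE vN]].
  have braid : gen i * gen j * gen i = gen j * gen i * gen j.
    have := WordRel (ArtinBraid eij); move=> /presentedP.
    by rewrite !presented_pi_cons !mulgA /= -[\pi_G [::]]/(1 : G) !mulg1.
  (* The correcting factor measures the failure of the braid relation between
     v and u j, so it is trivial in the quotient, and it has exponent
     N - exponent (u j). *)
  exists (u j * ((u j * v * u j)^-1 * (v * u j * v))); split.
    have pp x y : p (x * y) = p x * p y by exact: gmulfM.
    have pV x : p x^-1 = (p x)^-1 by exact: gmulfV.
    rewrite pp pp pV !pp vE uE -!gmulfM braid.
    by rewrite mulVg mulg1.
  by rewrite !exponentM exponentV !exponentM vN; lia.
have evalE w : p (word_eval v w) = psi (p (\pi_G w)).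
  elim: w => [|[i b] w IH].
    by rewrite /word_eval big_nil -[\pi_G [::]]/(1 : G) !gmulf1.
  rewrite presented_pi_cons /word_eval big_cons !gmulfM -IH; congr (_ * _).
  case: b; first exact: (vP i).1.
  by rewrite [LHS]gmulfV !gmulfV; congr _^-1; exact: (vP i).1.
have expE w : exponent (word_eval v w) = (N * word_exponent w)%R.
  elim: w => [|[i b] w IH].
    by rewrite /word_eval /word_exponent !big_nil exponent1 GRing.mulr0.
  rewrite /word_eval /word_exponent !big_cons exponentM IH GRing.mulrDr.
  congr (_ + _)%R; case: b => /=; rewrite ?exponentV (vP i).2; lia.
have vR x y : artin_rel e x y -> word_eval v x = word_eval v y.
  move=> /(@WordRel _ _ _ _) xy; apply: (mulgI (word_eval v x)^-1).
  rewrite mulVg; apply/esym/center_exponent0.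
    apply/central_quotientP; rewrite [LHS]evalE [RHS]evalE.
    by congr (psi (p _)); apply/presentedP.
  rewrite exponentM exponentV !expE (word_exponent_cong xy); lia.
have [phi phiE] := presented_lift vR.
have pphi x : p (phi x) = psi (p x).
  move: x; apply: presented_ind => [|i x IH|i x IH]; first by rewrite !gmulf1.
    by rewrite !gmulfM IH phiE (vP i).1.
  by rewrite !gmulfM !gmulfV IH phiE (vP i).1.
have phiZ : phi @` center G `<=` center G.
  move=> _ [z /central_quotient_pi1 Zz <-]; apply/central_quotient_pi1.
  by rewrite [LHS]pphi [p z]Zz gmulf1.
exists phi, phiZ; elim/quotW=> x.
by rewrite inducedE; apply: pphi.
Qed.

End Lift.

(** * A central element of the Artin monoid of type D *)

(** The elements a and b are the two short legs of the graph, and p 0, ..., p m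
    is its long leg, read from the branching vertex. *)
Section FullTwist.
Variables (H : monoidType) (a b : H) (p : nat -> H) (m : nat).
Hypothesis ab : commute a b.
Hypothesis ap0 : a * p 0 * a = p 0 * a * p 0.
Hypothesis bp0 : b * p 0 * b = p 0 * b * p 0.
Hypothesis ap : forall k, 0 < k <= m -> commute a (p k).
Hypothesis bp : forall k, 0 < k <= m -> commute b (p k).
Hypothesis pp : forall k, k < m -> p k * p k.+1 * p k = p k.+1 * p k * p k.+1.
Hypothesis pp_far : forall j k, j.+1 < k <= m -> commute (p j) (p k).

(** The analogue of the braid in which one strand turns once around the
    previous ones. *)
Fixpoint twist (k : nat) : H :=
  if k is k'.+1 then p k' * twist k' * p k' else a * b.

Lemma twist_far j k : k < j <= m -> commute (p j) (twist k).
Proof.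
elim: k => [|k IH] jk /=.
  by apply: commuteM; apply: commute_sym; [apply: ap | apply: bp]; lia.
have pjk : commute (p j) (p k) by apply/commute_sym/pp_far; lia.
by do 2!apply: commuteM => //; apply: IH; lia.
Qed.

(** Conjugation by a twist of positive index induces the diagram automorphism
    that exchanges the two short legs. *)
Lemma twist_swap k : k <= m ->
  a * twist k.+1 = twist k.+1 * b /\ b * twist k.+1 = twist k.+1 * a.
Proof.
elim: k => [|k IH] km.
  rewrite /=; split.
    by rewrite !mulgA ap0 -!mulgA [in RHS](mulgA b) bp0 !mulgA.
  by rewrite ab !mulgA bp0 -!mulgA [in RHS](mulgA a) ap0 !mulgA.
have [Ea Eb] := IH (ltnW km).
have apk : commute a (p k.+1) by apply: ap; lia.
have bpk : commute b (p k.+1) by apply: bp; lia.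
rewrite -[twist _]/(p k.+1 * twist k.+1 * p k.+1).
move: (twist _) Ea Eb => t Ea Eb; split.
  by rewrite !mulgA apk -[in LHS](mulgA _ a) Ea -!mulgA bpk.
by rewrite !mulgA bpk -[in LHS](mulgA _ b) Eb -!mulgA apk.
Qed.

(** For j = k - 1 this comes from sliding the braid relation between p (k - 1)
    and p k through the twist of index k - 1, which commutes with p k. *)
Lemma twist_path j k : j < k <= m -> commute (p j) (twist k.+1).
Proof.
elim: k => // k IH jk.
have [ltjk | lekj] := ltnP j k.
  have pjk : commute (p j) (p k.+1) by apply: pp_far; lia.
  apply: commuteM => //; apply: commuteM => //; apply: IH; lia.
have -> : j = k by lia.
rewrite /commute /=.
have pk : k < m by lia.
have far : commute (p k.+1) (twist k) by apply: twist_far; lia.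
rewrite !mulgA pp // -!mulgA; congr (_ * (_ * _)).
rewrite (mulgA (p k.+1)) far -!mulgA; congr (_ * _).
by rewrite !mulgA pp.
Qed.

(** The exchange of a and b is invisible on smaller twists, in which a and b
    only occur through their product. *)
Lemma twist_comm i k : i <= k <= m -> commute (twist i) (twist k.+1).
Proof.
move=> ik; apply: commute_sym.
elim: i ik => [|i IH] ik.
  have [Ea Eb] : a * twist k.+1 = twist k.+1 * b /\ b * twist k.+1 = twist k.+1 * a.
    by apply: twist_swap; lia.
  move: (twist k.+1) Ea Eb => t Ea Eb; apply: commute_sym.
  by rewrite /commute /= -mulgA Eb mulgA Ea -mulgA -ab.
have pik : commute (twist k.+1) (p i) by apply/commute_sym/twist_path; lia.
by do 2!apply: commuteM => //; apply: IH; lia.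
Qed.

(** For k = m + 2 this is the Garside element of type D, a product of twists of
    lengths 2, 4, ..., 2 (m + 2). *)
Definition half_twist (k : nat) : H := \prod_(0 <= i < k) twist i.

Lemma half_twistS k : half_twist k.+1 = half_twist k * twist k.
Proof. by rewrite /half_twist big_nat_recr. Qed.

(** The letter p j commutes with each twist except those of index j and j + 1,
    and with their product, since twist (j + 1) = p j * twist j * p j commutes
    with twist j. *)
Lemma half_twist_path j k : j < k <= m.+1 -> commute (p j) (half_twist k.+1).
Proof.
elim: k => // k IH jk; rewrite half_twistS.
have [ltjk | lekj] := ltnP j k.
  by apply: commuteM; [apply: IH | apply: twist_path]; lia.
have -> : j = k by lia.
have km : k <= m by lia.
rewrite half_twistS -mulgA; apply: commuteM.
  rewrite /half_twist big_nat; apply: commute_prod => i ik.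
  by apply: twist_far; lia.
have E : commute (twist k) (twist k.+1) by apply: twist_comm; lia.
by rewrite /commute [in RHS]E /= !mulgA.
Qed.

Lemma half_twist_swap k : k <= m.+1 ->
  a * half_twist k.+1 = half_twist k.+1 * a /\
    b * half_twist k.+1 = half_twist k.+1 * b \/
  a * half_twist k.+1 = half_twist k.+1 * b /\
    b * half_twist k.+1 = half_twist k.+1 * a.
Proof.
elim: k => [|k IH] km.
  left; rewrite /half_twist big_nat1 /=; split.
    by rewrite -mulgA -ab.
  by rewrite mulgA -ab.
have [Ea Eb] := twist_swap km.
rewrite half_twistS; move: (twist k.+1) Ea Eb => t Ea Eb.
case: (IH (ltnW km)) => -[Ha Hb]; [right | left].
  by rewrite !mulgA Ha Hb -!mulgA Ea Eb.
by rewrite !mulgA Ha Hb -!mulgA Ea Eb.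
Qed.

Definition full_twist : H := half_twist m.+2 * half_twist m.+2.

Lemma full_twist_central :
  [/\ commute a full_twist, commute b full_twist &
      forall j, j <= m -> commute (p j) full_twist].
Proof.
split; last first.
  by move=> j jm; apply: commuteM; apply: half_twist_path; lia.
all: rewrite /commute /full_twist; case: (half_twist_swap (leqnn m.+1)) => -[Ha Hb].
all: by rewrite mulgA ?Ha ?Hb -!mulgA ?Ha ?Hb.
Qed.

End FullTwist.

(** * The Coxeter graph of type D *)

Section TypeD.
Variable m : nat.
Local Notation e := (@D_edge m.+3).

Lemma D_edge_sym n : symmetric (@D_edge n).
Proof. by move=> i j; rewrite /D_edge orbC. Qed.

Lemma D_edge_trianglefree r s t : e r s -> e s t -> ~~ e r t.
Proof. rewrite /D_edge /D_arc; lia. Qed.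

Lemma D_edge_inord (i j : nat) : i < m.+3 -> j < m.+3 ->
  e (inord i) (inord j) = D_arc m.+3 i.+1 j.+1 || D_arc m.+3 j.+1 i.+1.
Proof. by move=> im jm; rewrite /D_edge !inordK. Qed.

Lemma D_edge_connected (P : 'I_m.+3 -> Prop) :
  (forall i j, e i j -> P i -> P j) -> forall i j, P i -> P j.
Proof.
move=> Pe.
have step i j : i < m.+3 -> j < m.+3 -> D_arc m.+3 i.+1 j.+1 ->
    P (inord i) <-> P (inord j).
  move=> im jm ij; split; apply: Pe; rewrite D_edge_inord // ij //.
  by rewrite orbT.
have path k : k < m.+2 -> P (inord 0) <-> P (inord k).
  elim: k => // k IH km; rewrite IH 1?ltnW //; apply: step; rewrite /D_arc; lia.
have all0 (k : 'I_m.+3) : P (inord 0) <-> P k.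
  rewrite -[k]inord_val; have [km | km] := ltnP k m.+2; first exact: path.
  by rewrite (path m) //; apply: step; rewrite // /D_arc; have := ltn_ord k; lia.
by move=> i j /all0/all0.
Qed.

(** The vertices are numbered from the end of the long leg, whence the reversed
    index in p; the branching vertex has index m and the short legs are the
    vertices m + 1 and m + 2. *)
Lemma D_monoid_central : exists C : artin_monoid e, central C /\ C != 1.
Proof.
pose at_ k := atom e (inord k).
have braid i j : i < m.+3 -> j < m.+3 -> D_arc m.+3 i.+1 j.+1 ->
    at_ i * at_ j * at_ i = at_ j * at_ i * at_ j.
  by move=> im jm ij; rewrite -!mulgA; apply: atom_braid; rewrite D_edge_inord // ij.
have comm i j : i < m.+3 -> j < m.+3 -> i != j -> ~~ D_arc m.+3 i.+1 j.+1 ->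
    ~~ D_arc m.+3 j.+1 i.+1 -> commute (at_ i) (at_ j).
  move=> im jm ij nij nji; apply: atom_comm.
    by rewrite -val_eqE /= !inordK.
  by rewrite D_edge_inord // negb_or nij.
pose p k := at_ (m - k).
have [|||||||Ca Cb Cp] :=
   @full_twist_central _ (at_ m.+1) (at_ m.+2) p m.
- by apply: comm; rewrite /D_arc; lia.
- by rewrite /p subn0; apply/esym/braid; rewrite /D_arc; lia.
- by rewrite /p subn0; apply/esym/braid; rewrite /D_arc; lia.
- by move=> k km; apply: comm; rewrite /D_arc; lia.
- by move=> k km; apply: comm; rewrite /D_arc; lia.
- by move=> k km; apply/esym/braid; rewrite /D_arc; lia.
- by move=> j k jk; apply: comm; rewrite /D_arc; lia.
set C := full_twist _ _ _ _ in Ca Cb Cp.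
exists C; split.
  move=> i; rewrite -[i]inord_val.
  have [im | im] := leqP i m.
    have := Cp (m - i)%N; rewrite /p subKn //; apply; lia.
  have [-> // | ne1] := eqVneq (i : nat) m.+1.
  have -> // : (i : nat) = m.+2 by have := ltn_ord i; lia.
apply/eqP => /(congr1 (@len _ e)).
rewrite len1 /C /full_twist /half_twist lenM big_nat_recl // lenM.
by rewrite lenM /at_ !len_atom.
Qed.

End TypeD.

Theorem proposition2p7 (n : nat) (hn : 4 <= n) (psi : endomorphism (artin_D_Z n)) :
  exists (phi : endomorphism (artin_D n))
         (phiZ : phi @` center (artin_D n) `<=` center (artin_D n)),
    induced phiZ =1 psi.
Proof.
case: n hn psi => [|[|[|m]]] // _ psi.
have sym := @D_edge_sym m.+3.
have tri := @D_edge_trianglefree m.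
have conn := @D_edge_connected m.
have [C [cC C1]] := D_monoid_central m.
have /choice[c Cc] : forall i, exists c, C = atom (@D_edge m.+3) i * c.
  exact: (twists_divides sym tri conn cC C1).
apply: (lift_endomorphism conn _ ord0) => z.
apply: (center_exponent0 sym tri cC Cc) => x y.
exact: central_eq.
Qed.
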